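(* Any family of depth-$2$ Boolean circuits deciding Latin Square Isotopy requires size $|G|^{\Omega(\log |G|)}$, where $|G|$ denotes the order of the input quasigroups.
   Context: A quasigroup $G$ of order $n=|G|$ on $[n]$ is given by its multiplication table, an $n\times n$ Latin square, each entry encoded by $\lceil\log_2 n\rceil$ bits. Two quasigroups $Q_1,Q_2$ are isotopic if there exist bijections $\alpha,\beta,\gamma:Q_1\to Q_2$ such that $\gamma(xy)=\alpha(x)\beta(y)$ for all $x,y\in Q_1$. Latin Square Isotopy takes as input two quasigroups $Q_1,Q_2$, given by multiplication tables, and asks whether they are isotopic; it is regarded as a total language, so a pair of tables that are not both multiplication tables of quasigroups is a no-instance. Circuits use AND, OR and NOT gates, with AND and OR gates of unbounded fan-in; depth-$2$ circuits are DNFs and CNFs (NOT gates are applied only to input variables). The size of a circuit is its number of gates. *)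

(* Defs.v *)
From mathcomp Require Import all_boot.

Set Implicit Arguments.
Unset Strict Implicit.
Unset Printing Implicit Defensive.

(* Circuits over a set I of input variables, as straight-line programs: the    *)
(* gates are listed in topological order and [GateOut j] is the output of the  *)
(* j-th gate.  Fan-in 0 is allowed (AND = true, OR = false), so that constant  *)
(* functions have circuits.                                                    *)
Inductive wire (I : Type) : Type :=
  | Input of I
  | GateOut of nat.

Arguments GateOut {I} _.

Inductive gate (I : Type) : Type :=
  | AndGate of seq (wire I)
  | OrGate of seq (wire I)
  | NotGate of wire I.

Definition fan_in (I : Type) (g : gate I) : seq (wire I) :=
  match g with
  | AndGate ws | OrGate ws => ws
  | NotGate w => [:: w]
  end.

Definition wire_lt (I : Type) (k : nat) (w : wire I) : bool :=
  if w is GateOut j then j < k else true.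

Fixpoint acyclic_from (I : Type) (k : nat) (gs : seq (gate I)) : bool :=
  if gs is g :: gs' then all (wire_lt k) (fan_in g) && acyclic_from k.+1 gs'
  else true.

Record circuit (I : Type) : Type := Circuit {
  gates : seq (gate I);
  output : wire I;
  _ : acyclic_from 0 gates && wire_lt (size gates) output
}.

Definition circuit_size (I : Type) (C : circuit I) : nat := size (gates C).

(* [vs] lists the values of the gates already evaluated; well-formedness of    *)
(* circuits makes the default value of [nth] irrelevant.                       *)
Definition wire_val (I : Type) (x : I -> bool) (vs : seq bool) (w : wire I) :
    bool :=
  match w with
  | Input i => x i
  | GateOut j => nth false vs j
  end.

Definition gate_val (I : Type) (x : I -> bool) (vs : seq bool) (g : gate I) :
    bool :=
  match g with
  | AndGate ws => all (wire_val x vs) ws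
  | OrGate ws => has (wire_val x vs) ws
  | NotGate w => ~~ wire_val x vs w
  end.

Definition gate_vals (I : Type) (x : I -> bool) (gs : seq (gate I)) :
    seq bool :=
  foldl (fun vs g => rcons vs (gate_val x vs g)) [::] gs.

Definition eval (I : Type) (C : circuit I) (x : I -> bool) : bool :=
  wire_val x (gate_vals x (gates C)) (output C).

Definition is_literal (I : Type) (gs : seq (gate I)) (w : wire I) : bool :=
  match w with
  | Input _ => true
  | GateOut j => if onth gs j is Some (NotGate (Input _)) then true else false
  end.

(* A one-literal term or clause may be wired without a gate of its own.        *)
Definition is_term (I : Type) (gs : seq (gate I)) (w : wire I) : bool :=
  is_literal gs w ||
  (if w is GateOut j then
     if onth gs j is Some (AndGate ws) then all (is_literal gs) ws else false
   else false).

Definition is_clause (I : Type) (gs : seq (gate I)) (w : wire I) : bool :=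
  is_literal gs w ||
  (if w is GateOut j then
     if onth gs j is Some (OrGate ws) then all (is_literal gs) ws else false
   else false).

Definition is_dnf (I : Type) (C : circuit I) : bool :=
  if output C is GateOut j then
    if onth (gates C) j is Some (OrGate ws) then all (is_term (gates C)) ws
    else false
  else false.

Definition is_cnf (I : Type) (C : circuit I) : bool :=
  if output C is GateOut j then
    if onth (gates C) j is Some (AndGate ws) then all (is_clause (gates C)) ws
    else false
  else false.

Definition depth2 (I : Type) (C : circuit I) : bool := is_dnf C || is_cnf C.

Definition quasigroup (Q : Type) (op : Q -> Q -> Q) : Prop :=
  (forall a, bijective (fun x => op a x)) /\
  (forall b, bijective (fun x => op x b)).

Definition isotopic (Q1 Q2 : Type) (op1 : Q1 -> Q1 -> Q1)
    (op2 : Q2 -> Q2 -> Q2) : Prop :=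
  exists alpha beta gamma : Q1 -> Q2,
    [/\ bijective alpha, bijective beta, bijective gamma &
        forall x y, gamma (op1 x y) = op2 (alpha x) (beta y)].

(* Input bits of a pair of n x n tables: (t, i, j, k) is bit k of the entry in *)
(* row i and column j of the first (t = false) or second (t = true) table;     *)
(* [up_log 2 n] is the ceiling of the binary logarithm of n.  The symbol set   *)
(* is {0, ..., n - 1}, written in binary with bit 0 least significant; when n  *)
(* is not a power of 2 an entry may thus fail to denote a symbol.              *)
Definition table_bit (n : nat) : Type :=
  (bool * 'I_n * 'I_n * 'I_(up_log 2 n))%type.

Definition entry (n : nat) (x : table_bit n -> bool) (t : bool) (i j : 'I_n) :
    nat :=
  \sum_(k < up_log 2 n) x (t, i, j, k) * 2 ^ k.

Definition encodes (n : nat) (x : table_bit n -> bool) (t : bool)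
    (op : 'I_n -> 'I_n -> 'I_n) : Prop :=
  forall i j, entry x t i j = op i j.

Definition latin_square_isotopy (n : nat) (x : table_bit n -> bool) : Prop :=
  exists op1 op2 : 'I_n -> 'I_n -> 'I_n,
    [/\ encodes x false op1, encodes x true op2,
        quasigroup op1, quasigroup op2 & isotopic op1 op2].

(* The circuit with index n handles the pairs of tables of order n.            *)
Definition circuit_family : Type := forall n : nat, circuit (table_bit n).

Definition decides_latin_square_isotopy (C : circuit_family) : Prop :=
  forall n, 0 < n ->
    forall x : table_bit n -> bool, eval (C n) x <-> latin_square_isotopy x.

(* Main.v *)
Require Import Defs.
From mathcomp Require Import all_boot all_order all_algebra.
From mathcomp Require Import all_classical all_reals all_analysis.
From mathcomp Require Import fintype finset zify.
Import Order.TTheory GRing.Theory Num.Theory.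

(* For a table order n = 2m + k with m odd and k <= 3, there are 2^(m(m - 2k)) *)
(* Latin squares on Z_m x Z_2 + Z_k, one for each choice of free bits indexed  *)
(* by Z_m x D with |D| = m - 2k: flipping a free bit switches one 2 x 2        *)
(* subsquare.  Translating Z_m by a shifts the free bits and gives an isotopic *)
(* square.                                                                     *)
(*   CNF: consider the pairs (f, g) of squares of this form.  A clause         *)
(* constraining w free bits in all, w^2 < m, is falsified by no pair, because  *)
(* some translation moves the constrained bits of f off those of g, so that    *)
(* the pair can be completed to an isotopic one.  A clause constraining more   *)
(* bits rejects a fraction at most 2^-w of all pairs, whereas most pairs are   *)
(* not isotopic: a square has at most n^(3n) isotopes.                         *)
(*   DNF: changing one bit of a pair of Latin squares destroys one of them, so *)
(* a term accepting a yes-instance reads all bits and accepts nothing else.    *)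
(* The bounds obtained are exponential in a power of n; only 2^(log n)^2 is    *)
(* kept.                                                                       *)

Set Implicit Arguments.
Unset Strict Implicit.
Unset Printing Implicit Defensive.

(** A small CNF cannot reject half of a cube while accepting densely in it, and a DNF needs a
    separate term for each yes-instance. The cube comes from [lsq_pair]: every table bit is constant
    or one free bit up to negation ([lsq_pair_dep]), so a satisfiable term cuts out a subcube.
    Isotopic pairs meet every subcube of codimension below [w] ([lsq_pair_dense]) but fill at most
    half of the cube (by [card_isotopic_lsq_pair]). Hence the negated clauses cover the other half
    by subcubes of density at most 2^-w, and [covering_bound] yields 2^(w-1) of them. For a DNF,
    [flip_bitP] forces a term satisfied by a yes-instance to isolate it, and [dnf_yes_bound] counts
    the pairs (f, f). With t the ceiling of log2 n and w = t^2 + 1, both counts are at least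
    2^(t^2), which is at least n^(ln n). *)

Section NormalForms.
Variable I : Type.
Implicit Types (x : I -> bool) (gs : seq (gate I)) (w : wire I) (l : I * bool).

(** * Evaluation of a circuit gate by gate *)

Lemma acyclic_from_rcons k gs g :
  acyclic_from k (rcons gs g) =
  acyclic_from k gs && all (wire_lt (k + size gs)) (fan_in g).
Proof.
elim: gs k => [|h gs IHgs] k /=; first by rewrite addn0 andbT.
by rewrite IHgs addSnnS andbA.
Qed.

Lemma gate_vals_rcons x gs g :
  gate_vals x (rcons gs g) =
  rcons (gate_vals x gs) (gate_val x (gate_vals x gs) g).
Proof. by rewrite /gate_vals foldl_rcons. Qed.

Lemma size_gate_vals x gs : size (gate_vals x gs) = size gs.
Proof.
by elim/last_ind: gs => // gs g IHgs; rewrite gate_vals_rcons !size_rcons IHgs.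
Qed.

Lemma wire_val_rcons x vs b w :
  wire_lt (size vs) w -> wire_val x (rcons vs b) w = wire_val x vs w.
Proof. by case: w => //= j ltj; rewrite nth_rcons ltj. Qed.

Lemma gate_val_rcons x vs b g :
  all (wire_lt (size vs)) (fan_in g) ->
  gate_val x (rcons vs b) g = gate_val x vs g.
Proof.
have eq_ws ws : all (wire_lt (size vs)) ws ->
    map (wire_val x (rcons vs b)) ws = map (wire_val x vs) ws.
  by elim: ws => //= w ws IHws /andP[/wire_val_rcons-> /IHws->].
case: g => [ws|ws|w] /=.
- by move/eq_ws => eqw; rewrite -[LHS](all_map _ id) eqw all_map.
- by move/eq_ws => eqw; rewrite -[LHS](has_map _ id) eqw has_map.
- by rewrite andbT => /wire_val_rcons->.
Qed.

Lemma onth_rcons (T : Type) (s : seq T) y j :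
  onth (rcons s y) j = if j == size s then Some y else onth s j.
Proof. by elim: s j => [|z s IHs] [|j] //=; rewrite ?IHs //; case: j. Qed.

(** Appending a gate leaves earlier values unchanged, and a gate only reads earlier gates. Its
    defining equation therefore persists in the complete list of values. *)
Lemma acyclic_onth gs j g :
  acyclic_from 0 gs -> onth gs j = Some g ->
  [/\ j < size gs, all (wire_lt j) (fan_in g) &
      forall x, nth false (gate_vals x gs) j = gate_val x (gate_vals x gs) g].
Proof.
elim/last_ind: gs => [|gs h IHgs]; first by case: j.
rewrite acyclic_from_rcons add0n size_rcons onth_rcons => /andP[acy fan].
case: eqP => [-> [<-]|_ /(IHgs acy)[ltj fanj valj]].
  split=> // x; rewrite gate_vals_rcons nth_rcons size_gate_vals ltnn eqxx.
  by rewrite gate_val_rcons ?size_gate_vals.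
split=> // [|x]; first exact: ltnW.
rewrite gate_vals_rcons nth_rcons size_gate_vals ltj valj gate_val_rcons //.
rewrite size_gate_vals; apply: sub_all fanj => -[] //= i /leq_trans; apply.
exact: ltnW.
Qed.

(** * Depth-2 circuits as lists of terms *)

Definition lit_val x l : bool := x l.1 == l.2.

Definition wire_lit gs w : seq (I * bool) :=
  match w with
  | Input i => [:: (i, true)]
  | GateOut j =>
      if onth gs j is Some (NotGate (Input i)) then [:: (i, false)] else [::]
  end.

(** The last case serves a NOT gate used as a one-literal term or clause. *)
Definition gate_lits gs j : seq (I * bool) :=
  match onth gs j with
  | Some (AndGate ws) | Some (OrGate ws) => flatten (map (wire_lit gs) ws)
  | _ => wire_lit gs (GateOut j)
  end.

Definition neg_lit l : I * bool := (l.1, ~~ l.2).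

Lemma lit_val_neg x l : lit_val x (neg_lit l) = ~~ lit_val x l.
Proof. by case: l => i [] /=; rewrite /lit_val /=; case: (x i). Qed.

Section Gates.
Variables (gs : seq (gate I)) (acy : acyclic_from 0 gs).

Lemma wire_lit_val w : is_literal gs w ->
  exists l, wire_lit gs w = [:: l] /\
    forall x, wire_val x (gate_vals x gs) w = lit_val x l.
Proof.
case: w => [i _|j] /=.
  by exists (i, true); split=> // x; rewrite /lit_val eqb_id.
case E: (onth gs j) => [[||[i|]]|] // _.
have [_ _ val] := acyclic_onth acy E.
by exists (i, false); split=> // x; rewrite val /lit_val eqbF_neg.
Qed.

Lemma wire_lits_val x ws : all (is_literal gs) ws ->
  map (wire_val x (gate_vals x gs)) ws =
  map (lit_val x) (flatten (map (wire_lit gs) ws)).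
Proof.
elim: ws => //= w ws IHws /andP[/wire_lit_val[l [-> ->]] /IHws->].
by rewrite map_cat.
Qed.

Lemma is_term_val x j : is_term gs (GateOut j) ->
  wire_val x (gate_vals x gs) (GateOut j) = all (lit_val x) (gate_lits gs j).
Proof.
case/orP.
  rewrite /gate_lits => /[dup] lit_j /wire_lit_val[l []].
  rewrite [is_literal _ _]/= in lit_j.
  by case: (onth gs j) lit_j => // -[] // w _ -> ->; rewrite /= andbT.
rewrite /gate_lits; case E: (onth gs j) => [[ws||]|] //= /(wire_lits_val x) eqws.
by have [_ _ ->] := acyclic_onth acy E; rewrite /=
  -[LHS](all_map _ id) eqws all_map.
Qed.

Lemma is_clause_val x j : is_clause gs (GateOut j) ->
  wire_val x (gate_vals x gs) (GateOut j) = has (lit_val x) (gate_lits gs j).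
Proof.
case/orP.
  rewrite /gate_lits => /[dup] lit_j /wire_lit_val[l []].
  rewrite [is_literal _ _]/= in lit_j.
  by case: (onth gs j) lit_j => // -[] // w _ -> ->; rewrite /= orbF.
rewrite /gate_lits; case E: (onth gs j) => [[|ws|]|] //= /(wire_lits_val x) eqws.
by have [_ _ ->] := acyclic_onth acy E; rewrite /=
  -[LHS](has_map _ id) eqws has_map.
Qed.

End Gates.

Definition input_wires (ws : seq (wire I)) : seq I :=
  pmap (fun w => if w is Input i then Some i else None) ws.

Definition uses_gate (ws : seq (wire I)) (j : nat) : bool :=
  has (fun w => if w is GateOut j' then j' == j else false) ws.

Definition gate_wires (N : nat) (ws : seq (wire I)) : seq nat :=
  [seq j <- iota 0 N | uses_gate ws j].

(* Listing the gates rather than the wires bounds their number by N even when *)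
(* a gate is wired several times.                                             *)
Lemma has_wires N (val : pred (wire I)) ws : all (wire_lt N) ws ->
  has val ws = has (fun i => val (Input i)) (input_wires ws)
            || has (fun j => val (GateOut j)) (gate_wires N ws).
Proof.
have has_gates us : has (fun j => val (GateOut j)) (gate_wires N us) =
    has (fun j => uses_gate us j && val (GateOut j)) (iota 0 N).
  by rewrite /gate_wires; elim: iota => //= j s <-; case: uses_gate.
rewrite has_gates; elim: ws => [_|w ws IHws /= /andP[ltw /IHws->]] /=.
  by rewrite has_pred0.
case: w ltw => [i _|j ltj] /=; first by rewrite orbA.
rewrite orbCA; congr (_ || _).
apply/idP/hasP => [/orP[vj|/hasP[j' ? /= /andP[uj vj]]]|[j' j'N /= /andP[]]].
- by exists j; rewrite ?mem_iota //= vj /uses_gate /= eqxx.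
- by exists j'; rewrite //= vj /uses_gate /= [has _ _]uj orbT.
rewrite /uses_gate /= => /orP[/eqP-> ->//|uj vj].
by apply/orP; right; apply/hasP; exists j'; rewrite //= vj andbT.
Qed.

Lemma all_wires N (val : pred (wire I)) ws : all (wire_lt N) ws ->
  all val ws = all (fun i => val (Input i)) (input_wires ws)
            && all (fun j => val (GateOut j)) (gate_wires N ws).
Proof.
move/(has_wires (predC val)) => eqv; rewrite -[LHS]negbK -has_predC eqv.
rewrite negb_or -!all_predC.
by congr (_ && _); apply: eq_all => j /=; rewrite negbK.
Qed.

(** Literals wired directly from inputs cost no gate, so they are kept apart in [ls], whose length
    is not bounded; the terms in [ts] come from distinct gates. *)
Lemma dnf_terms (C : circuit I) : is_dnf C ->
  exists ls ts, size ts <= circuit_size C /\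
    forall x, Defs.eval C x = has (lit_val x) ls || has (all (lit_val x)) ts.
Proof.
case: C => gs [i|j] wf; have [acy _] := andP wf; rewrite /is_dnf //=.
case E: (onth gs j) => [[|ws|]|] // terms.
have [ltj fan val] := acyclic_onth acy E.
have wsN : all (wire_lt (size gs)) ws.
  by apply: sub_all fan => -[] //= i /ltn_trans; apply.
exists [seq (i, true) | i <- input_wires ws].
exists [seq gate_lits gs i | i <- gate_wires (size gs) ws]; split.
  by rewrite size_map size_filter (leq_trans (count_size _ _)) ?size_iota.
move=> x; rewrite /Defs.eval /= val /= (has_wires _ wsN) !has_map; congr (_ || _).
  by apply: eq_has => i; rewrite /= /lit_val eqb_id.
move: terms; rewrite (all_wires _ wsN) => /andP[_ /allP terms].
by apply: eq_in_has => i /terms /(is_term_val acy x).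
Qed.

(** By De Morgan, rejection by a CNF is a disjunction of negated clauses, which are terms. *)
Lemma cnf_clauses (C : circuit I) : is_cnf C ->
  exists ls ts, size ts <= circuit_size C /\
    forall x, ~~ Defs.eval C x = has (lit_val x) ls || has (all (lit_val x)) ts.
Proof.
case: C => gs [i|j] wf; have [acy _] := andP wf; rewrite /is_cnf //=.
case E: (onth gs j) => [[ws||]|] // clauses.
have [ltj fan val] := acyclic_onth acy E.
have wsN : all (wire_lt (size gs)) ws.
  by apply: sub_all fan => -[] //= i /ltn_trans; apply.
exists [seq (i, false) | i <- input_wires ws].
exists [seq map neg_lit (gate_lits gs i) | i <- gate_wires (size gs) ws]; split.
  by rewrite size_map size_filter (leq_trans (count_size _ _)) ?size_iota.
move=> x; rewrite /Defs.eval /= val /= -has_predC (has_wires _ wsN) !has_map.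
congr (_ || _); first by apply: eq_has => i; rewrite /= /lit_val eqbF_neg.
move: clauses; rewrite (all_wires _ wsN) => /andP[_ /allP clauses].
apply: eq_in_has => i /clauses /(is_clause_val acy x) /= ->.
by rewrite -all_predC all_map; apply: eq_all => l /=; rewrite lit_val_neg.
Qed.

End NormalForms.

(** * Terms as subcubes, and the covering bound for CNFs *)

Section Subcubes.
Variables (V : finType) (I : eqType) (inst : {ffun V -> bool} -> I -> bool).

Hypothesis inst_dep : forall i, (exists c, forall v, inst v i = c) \/
  (exists u b, forall v, inst v i = v u (+) b).

(** By [inst_dep] each literal is constant or fixes one coordinate, necessarily to its value at
    [v0]. *)
Lemma term_subcube ls v0 : all (lit_val (inst v0)) ls ->
  exists S : {set V}, #|S| <= size ls /\
    forall v, all (lit_val (inst v)) ls = [forall u in S, v u == v0 u].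
Proof.
elim: ls => [_|[i b] ls IHls /= /andP[lit_i /IHls[S [leS eqS]]]].
  exists set0; rewrite cards0; split=> // v.
  by apply/esym/forall_inP => u; rewrite inE.
case: (inst_dep i) => [[c ic]|[u [c ic]]].
  exists S; split=> [|v]; first exact: leqW.
  by rewrite -eqS /lit_val /= ic -(ic v0) [_ == b]lit_i.
exists (u |: S); split=> [|v].
  by rewrite cardsU1 -add1n leq_add // leq_b1.
rewrite eqS; have -> : lit_val (inst v) (i, b) = (v u == v0 u).
  move: lit_i; rewrite /lit_val /= !ic => /eqP <-.
  by rewrite (inj_eq (@addIb c)).
apply/andP/forall_inP => [[/eqP vu /forall_inP vS] u'|vS].
  by case/setU1P => [->|/vS//]; rewrite vu.
split; first by apply: vS; rewrite setU11.
by apply/forall_inP => u' Su'; apply: vS; rewrite setU1r.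
Qed.

Lemma card_subcube (S : {set V}) (v0 : {ffun V -> bool}) :
  #|[set v : {ffun V -> bool} | [forall u in S, v u == v0 u]]| * 2 ^ #|S|
  = 2 ^ #|V|.
Proof.
pose F u : pred bool := if u \in S then pred1 (v0 u) else predT.
have -> : #|[set v : {ffun V -> bool} | [forall u in S, v u == v0 u]]|
         = #|(family F : simpl_pred {dffun forall u : V, bool})|.
  apply: eq_card => v; rewrite inE; apply/forall_inP/familyP => vS u.
    by rewrite /F; case: ifP => // /vS.
  by move=> Su; have := vS u; rewrite /F Su.
rewrite card_family foldrE big_map big_enum /= -sum1_card.
rewrite (big_mkcond (mem S)) /= expn_sum -big_split /= -prod_nat_const.
apply: eq_bigr => u _; rewrite /F; case: ifP => _.
  by rewrite card1.
by rewrite card_bool.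
Qed.

Variables (acc : pred {ffun V -> bool}) (w : nat).
Hypothesis acc_dense : forall (S : {set V}) (v0 : {ffun V -> bool}), #|S| < w ->
  exists2 v, acc v & {in S, v =1 v0}.

(** If the subcube of a satisfiable term fixed fewer than [w] coordinates, [acc_dense] would put an
    accepted point in it. So at least [w] coordinates are fixed, which takes at least [w]
    literals. *)
Lemma card_rejecting_term ls :
    (forall v, all (lit_val (inst v)) ls -> ~~ acc v) ->
  #|[set v | all (lit_val (inst v)) ls]| * 2 ^ w <= 2 ^ #|V|
  /\ (size ls < w -> forall v, ~~ all (lit_val (inst v)) ls).
Proof.
move=> rej; case: (boolP [exists v, all (lit_val (inst v)) ls]); last first.
  move/existsPn => none; split=> //.
  by rewrite eq_card0 // => v; rewrite !inE (negPf (none v)).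
case/existsP => v0 /term_subcube[S [leS eqS]].
have leqS : w <= #|S|.
  rewrite leqNgt; apply/negP => /(acc_dense v0)[v acc_v vS].
  suff /rej/negP : all (lit_val (inst v)) ls by [].
  by rewrite eqS; apply/forall_inP => u /vS->.
split=> [|ltw]; last by have := leq_trans (leq_trans ltw leqS) leS; rewrite ltnn.
rewrite -(card_subcube S v0) leq_mul ?leq_pexp2l //.
by apply: eq_leq; apply: eq_card => v; rewrite !inE eqS.
Qed.

(** Union bound: each term covers at most a 2^-w fraction of the cube, and at least half of it must
    be covered. Single literals are too short to reject anything, as [w] exceeds 1. *)
Lemma covering_bound ls ts : 1 < w ->
    (forall v, ~~ acc v =
      has (lit_val (inst v)) ls || has (all (lit_val (inst v))) ts) ->
    2 * #|acc| <= 2 ^ #|V| ->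
  2 ^ w.-1 <= size ts.
Proof.
move=> w_gt1 accE le_acc.
have no_ls v : has (lit_val (inst v)) ls = false.
  apply/negbTE/hasPn => l ls_l.
  have [|_ /(_ w_gt1 v)] := @card_rejecting_term [:: l]; last by rewrite /= andbT.
  by move=> u /= /andP[lu _]; rewrite accE; apply/orP; left; apply/hasP; exists l.
have cover us : {subset us <= ts} ->
    #|[set v | has (all (lit_val (inst v))) us]| * 2 ^ w <= size us * 2 ^ #|V|.
  elim: us => [_|t us IHus sub_us].
    by rewrite eq_card0 // => v; rewrite !inE.
  have [|le_t _] := @card_rejecting_term t.
    move=> v tv; rewrite accE; apply/orP; right; apply/hasP; exists t => //.
    by apply: sub_us; rewrite mem_head.
  have /IHus le_us : {subset us <= ts}.
    by move=> u us_u; apply: sub_us; rewrite inE us_u orbT.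
  rewrite /= mulSn (leq_trans _ (leq_add le_t le_us)) // -mulnDl leq_mul2r.
  apply/orP; right; apply: leq_trans (leq_card_setU _ _).
  by apply: eq_leq; apply: eq_card => v; rewrite !inE.
have eq_rej : #|[set v | has (all (lit_val (inst v))) ts]| = #|predC acc|.
  by apply: eq_card => v; rewrite !inE -[RHS]/(~~ acc v) accE no_ls.
have := cover ts (fun _ => id); rewrite eq_rej -(prednK (ltnW w_gt1)) expnS.
have := cardC acc; rewrite card_ffun card_bool => cardV le_rej.
rewrite -(@leq_pmul2r (2 ^ #|V|)) ?expn_gt0 //; apply: leq_trans le_rej.
rewrite mulnA [_ * 2]mulnC mulnC leq_mul2r; apply/orP; right.
by move: le_acc; rewrite -cardV !mul2n -!addnn leq_add2l leq_add2r.
Qed.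

End Subcubes.

(** * Binary entries, single bit flips, and the DNF bound *)

Definition nat_bit (m k : nat) : bool := odd (m %/ 2 ^ k).

Lemma sum_nat_bit t m : m < 2 ^ t -> \sum_(k < t) nat_bit m k * 2 ^ k = m.
Proof.
elim: t m => [|t IHt] m ltm; first by rewrite big_ord0; case: m ltm.
rewrite big_ord_recl /nat_bit /= divn1 muln1.
under eq_bigr => k _ do rewrite /bump add1n expnS divnMA divn2 mulnCA.
rewrite -big_distrr /= IHt; first by rewrite mul2n odd_double_half.
by rewrite -divn2 ltn_divLR // -expnSr.
Qed.

Lemma entry_inj n (x y : table_bit n -> bool) t i j :
  (forall k, x (t, i, j, k) = y (t, i, j, k)) -> entry x t i j = entry y t i j.
Proof. by move=> eqxy; apply: eq_bigr => k _; rewrite eqxy. Qed.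

Definition flip_bit n (x : table_bit n -> bool) (i : table_bit n) :
  table_bit n -> bool := fun i' => x i' (+) (i' == i).

(** A flip alters exactly one entry of one table, while an entry of a Latin square is determined by
    the rest of its row. *)
Lemma flip_bitP n (x : table_bit n -> bool) i :
  latin_square_isotopy x -> ~ latin_square_isotopy (flip_bit x i).
Proof.
have flip_other t i' j' : (t, i', j') != i.1 ->
    entry (flip_bit x i) t i' j' = entry x t i' j'.
  move=> neq; apply: entry_inj => k; rewrite /flip_bit.
  have -> : ((t, i', j', k) == i) = false; last by rewrite addbF.
  by apply: contraNF neq => /eqP<-.
have flip_same : entry (flip_bit x i) i.1.1.1 i.1.1.2 i.1.2
              <> entry x i.1.1.1 i.1.1.2 i.1.2.
  case: i {flip_other} => [[[t i] j] k] /=.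
  rewrite /entry (bigD1 k) // [in RHS](bigD1 k) //=.
  have -> : \sum_(i0 < up_log 2 n | i0 != k)
      flip_bit x (t, i, j, k) (t, i, j, i0) * 2 ^ i0
    = \sum_(i0 < up_log 2 n | i0 != k) x (t, i, j, i0) * 2 ^ i0.
    apply: eq_bigr => k' neq; rewrite /flip_bit.
    have -> : ((t, i, j, k') == (t, i, j, k)) = false; last by rewrite addbF.
    by apply: contraNF neq => /eqP[->].
  rewrite /flip_bit eqxx => /addIn/eqP.
  by rewrite eqn_mul2r expn_eq0 /=; case: (x _).
have same_row (op op' : 'I_n -> 'I_n -> 'I_n) :
    encodes x i.1.1.1 op -> encodes (flip_bit x i) i.1.1.1 op' ->
    quasigroup op -> quasigroup op' -> False.
  move=> enc enc' [/(_ i.1.1.2) bij _] [/(_ i.1.1.2) [inv inv1 inv2] _].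
  pose j := inv (op i.1.1.2 i.1.2).
  have opj : op' i.1.1.2 j = op i.1.1.2 i.1.2 by rewrite /j inv2.
  have [ej|nej] := eqVneq j i.1.2.
    by apply: flip_same; rewrite enc enc' -opj ej.
  case/eqP: (nej); apply: (bij_inj bij); apply: val_inj => /=.
  rewrite -opj -enc' flip_other ?enc //.
  by apply: contra_neq nej => eq_i; rewrite -[LHS]/(i.1.1.1, i.1.1.2, j).2 eq_i.
case=> [op1 [op2 [e1 e2 q1 q2 _]]] [op1' [op2' [e1' e2' q1' q2' _]]].
case ti : i.1.1.1.
  by apply: (same_row op2 op2'); rewrite ?ti.
by apply: (same_row op1 op1'); rewrite ?ti.
Qed.

(** Flipping an unread bit would keep the term true and turn the yes-instance into a no-instance. *)
Lemma accepting_term_reads_all n (x y : table_bit n -> bool) ls :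
    latin_square_isotopy x -> all (lit_val x) ls ->
    (forall z, all (lit_val z) ls -> latin_square_isotopy z) ->
  all (lit_val y) ls -> x =1 y.
Proof.
move=> yes_x xls acc yls i.
have /mapP[[i' b] ls_i /= ->] : i \in map fst ls.
  apply/negPn/negP => nls; apply: (@flip_bitP _ x i yes_x); apply: acc.
  rewrite -(eq_in_all (a1 := lit_val x)) // => l ls_l; rewrite /lit_val /flip_bit.
  have -> : (l.1 == i) = false; last by rewrite addbF.
  by apply: contraNF nls => /eqP <-; apply: map_f.
have := allP xls _ ls_i; have := allP yls _ ls_i; rewrite /lit_val /=.
by move=> /eqP-> /eqP->.
Qed.

Lemma dnf_yes_bound n (C : circuit (table_bit n)) (F : finType)
    (inst : F -> table_bit n -> bool) : 1 < n -> is_dnf C ->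
    (forall x, Defs.eval C x <-> latin_square_isotopy x) ->
    (forall u v, inst u =1 inst v -> u = v) ->
    (forall u, latin_square_isotopy (inst u)) ->
  #|F| <= circuit_size C.
Proof.
move=> n_gt1 /dnf_terms[ls [ts [le_ts evalC]]] decC inst_inj yes.
have no_ls u : has (lit_val (inst u)) ls = false.
  apply/negbTE/hasPn => l ls_l; apply/negP => lu.
  case: l ls_l lu => -[[[t i] j] k] b ls_l lu.
  (* A lone literal cannot accept: a flip in the other table leaves it true. *)
  apply: (@flip_bitP _ (inst u) (~~ t, i, j, k)) => //.
  apply/decC; rewrite evalC; apply/orP; left; apply/hasP.
  exists (t, i, j, k, b) => //; rewrite /lit_val /flip_bit /= in lu *.
  by rewrite !xpair_eqE; case: t lu {ls_l}; rewrite /= addbF.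
have ts_u u : has (all (lit_val (inst u))) ts.
  by have /decC := yes u; rewrite evalC no_ls.
have lt_find u : find (all (lit_val (inst u))) ts < circuit_size C.
  by apply: leq_trans le_ts; rewrite -has_find.
rewrite -[X in _ <= X]card_ord.
apply: (@leq_card _ _ (fun u => Ordinal (lt_find u))).
move=> u v [] eq_find; apply: inst_inj.
pose t := nth [::] ts (find (all (lit_val (inst u))) ts).
apply: (@accepting_term_reads_all _ _ _ t) => //.
- exact: nth_find.
- move=> z tz; apply/decC; rewrite evalC; apply/orP; right; apply/(has_nthP [::]).
  by exists (find (all (lit_val (inst u))) ts); rewrite // -has_find.
- by rewrite /t eq_find; apply: nth_find.
Qed.

(** * Latin squares with free bits, and their isotopies *)

Section LatinSquares.
Local Open Scope ring_scope.
Variables (G : finZmodType) (K D : finType) (opK : K -> K -> K).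
Variables (lab : G -> bool * K + D) (delta : bool * K + D -> G).
Hypotheses (labK : cancel lab delta) (deltaK : cancel delta lab).
Hypothesis double_inj : injective (fun x : G => x + x).
Hypotheses (opK_injl : forall i, injective (opK i))
           (opK_injr : forall j, injective (opK^~ j)).

Notation T := ((G * bool) + K)%type.

(* The cells in row (x, s) and column (y, s) with [lab (y - x) = inl (s, j)]  *)
(* form a transversal, which is prolonged by the symbol [inr j]; doubling has *)
(* to be injective for the displaced symbols to be distinct.                  *)
Definition lsq (f : G * D -> bool) (u v : T) : T :=
  match u, v with
  | inl (x, s), inl (y, t) =>
      match lab (y - x) with
      | inl (b, j) =>
          if (s == b) && (t == b) then inr j else inl (x + y, s (+) t (+) b)
      | inr d => inl (x + y, s (+) t (+) f (x, d))
      end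
  | inl (x, s), inr j => inl (x + x + delta (inl (s, j)), s)
  | inr j, inl (y, t) => inl (y + y - delta (inl (t, j)), t)
  | inr i, inr j => inr (opK i j)
  end.

Lemma lsq_injl f u : injective (lsq f u).
Proof.
(* The first coordinates agree only at difference [delta (inl (s, j))]. There the cell with t = s
   holds [inr j], and the other cell has second coordinate t, which differs from s. *)
have mixed x s y t j : lsq f (inl (x, s)) (inl (y, t)) =
    lsq f (inl (x, s)) (inr j) -> False.
  rewrite /lsq; case E: (lab (y - x)) => [[b i]|d].
    case: ifP => // neq [exy est]; have ey : y = x + delta (inl (s, j)).
      by apply: (addrI x); rewrite addrA.
    move: E; rewrite ey addrC addKr deltaK => -[eb _].
    by move: neq est; rewrite -eb eqxx; case: (s); case: (t).
  case=> exy _; have ey : y = x + delta (inl (s, j)).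
    by apply: (addrI x); rewrite addrA.
  by move: E; rewrite ey addrC addKr deltaK.
case: u => [[x s]|i] [[y t]|j] [[y' t']|j'].
- rewrite /lsq; case E: (lab (y - x)) => [[b j]|d];
    case E': (lab (y' - x)) => [[b' j']|d'].
  + case: ifP => [/andP[/eqP-> /eqP->]|_]; case: ifP => //.
      move=> /andP[/eqP eb' /eqP->] [ej].
      have /addIr-> : y - x = y' - x.
        by rewrite -[LHS]labK -[RHS]labK E E' -eb' ej.
      by rewrite eb'.
    move=> _ [] /addrI ey; move: E'; rewrite -ey E => -[<- _].
    by rewrite -!addbA => /addbI/addIb->.
  + case: ifP => // _ [/addrI ey]; by move: E'; rewrite -ey E.
  + case: ifP => // _ [/addrI ey]; by move: E'; rewrite -ey E.
  + case=> /addrI ey; move: E'; rewrite -ey E => -[<-].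
    by rewrite -!addbA => /addbI/addIb->.
- by move/mixed.
- by move/esym/mixed.
- by case=> /addrI /(can_inj deltaK) [->].
- case=> + et; rewrite et => /addIr.
  by move/double_inj->.
- by [].
- by [].
- by case=> /opK_injl->.
Qed.

Lemma lsq_injr f v : injective (fun u => lsq f u v).
Proof.
have mixed x s y t j : lsq f (inl (x, s)) (inl (y, t)) =
    lsq f (inr j) (inl (y, t)) -> False.
  have ed : x + y = y + y - delta (inl (t, j)) -> y - x = delta (inl (t, j)).
    move=> exy; apply: (addIr (x - delta (inl (t, j)))).
    rewrite addrA subrK (addrC x) addrA subrr add0r; apply: (addrI y).
    by rewrite addrA -exy addrC.
  rewrite /lsq; case E: (lab (y - x)) => [[b i]|d].
    case: ifP => // neq [/ed ey est].
    move: E; rewrite ey deltaK => -[eb _].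
    by move: neq est; rewrite -eb eqxx; case: (s); case: (t).
  by case=> /ed ey _; move: E; rewrite ey deltaK.
case: v => [[y t]|j] [[x s]|i] [[x' s']|i'].
- rewrite /lsq; case E: (lab (y - x)) => [[b j]|d];
    case E': (lab (y - x')) => [[b' j']|d'].
  + case: ifP => [/andP[/eqP-> /eqP eb]|_]; case: ifP => //.
      move=> /andP[/eqP-> /eqP eb'] [ej]; have /addrI/oppr_inj-> : y - x = y - x'.
        by rewrite -[LHS]labK -[RHS]labK E E' -eb' eb ej.
      by rewrite -eb eb'.
    move=> _ [] /addIr ex; move: E'; rewrite -ex E => -[<- _].
    by move/addIb/addIb->.
  + case: ifP => // _ [/addIr ex]; by move: E'; rewrite -ex E.
  + case: ifP => // _ [/addIr ex]; by move: E'; rewrite -ex E.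
  + case=> /addIr ex; move: E'; rewrite -ex E => -[<-].
    by move/addIb/addIb->.
- by move/mixed.
- by move/esym/mixed.
- by case=> /addrI/oppr_inj/(can_inj deltaK) [->].
- case=> + es; rewrite es => /addIr.
  by move/double_inj->.
- by [].
- by [].
- by case=> /opK_injr->.
Qed.

Lemma quasigroup_lsq f : quasigroup (lsq f).
Proof.
split=> a; apply: injF_bij; [exact: lsq_injl | exact: lsq_injr].
Qed.

(** Translating rows and columns by [a] preserves the differences y - x, hence the labels; symbols
    move by [a + a] and the elements of [K] stay fixed. *)
Lemma isotopic_lsq_shift (a : G) f f' :
  (forall x d, f (x, d) = f' (x + a, d)) -> isotopic (lsq f) (lsq f').
Proof.
move=> ff'; pose tau c (u : T) := if u is inl (x, s) then inl (x + c, s) else u.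
have bij_tau c : bijective (tau c).
  by apply: injF_bij => -[[x s]|i] [[y t]|j] //= [] /addIr-> ->.
exists (tau a), (tau a), (tau (a + a)); split=> // -[[x s]|i] [[y t]|j] //=.
- rewrite opprD addrACA subrr addr0 (addrACA x a).
  by case: (lab _) => [[b j]|d]; [case: ifP | rewrite ff'].
- by rewrite (addrACA x a); congr (inl (_, _)); apply: addrAC.
- by rewrite (addrACA y a); congr (inl (_, _)); apply: addrAC.
Qed.

Lemma lsq_read (f : G * D -> bool) (x : G) (d : D) :
  lsq f (inl (x, false)) (inl (x + delta (inr d), false)) =
  inl (x + (x + delta (inr d)), f (x, d)).
Proof. by rewrite /lsq addrC addKr deltaK. Qed.

Lemma lsq_dep (u v : T) :
  (exists c, forall f, lsq f u v = c) \/
  (exists p z s, forall f, lsq f u v = inl (z, f p (+) s)).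
Proof.
case: u v => [[x s]|i] [[y t]|j]; last 3 first.
- by left; exists (inl (x + x + delta (inl (s, j)), s)).
- by left; exists (inl (y + y - delta (inl (t, i)), t)).
- by left; exists (inr (opK i j)).
rewrite /lsq; case: (lab (y - x)) => [[b j]|d].
  by left; exists (if (s == b) && (t == b) then inr j
                   else inl (x + y, s (+) t (+) b)).
by right; exists (x, d), (x + y), (s (+) t) => f; rewrite addbC.
Qed.

Variables (n : nat) (e : T -> 'I_n) (e' : 'I_n -> T).
Hypotheses (eK : cancel e e') (e'K : cancel e' e).

Definition lsq_ord f (i j : 'I_n) : 'I_n := e (lsq f (e' i) (e' j)).

Lemma quasigroup_lsq_ord f : quasigroup (lsq_ord f).
Proof.
split=> a; apply: injF_bij => i j /(can_inj eK).
  by move/lsq_injl/(can_inj e'K).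
by move/lsq_injr/(can_inj e'K).
Qed.

Lemma isotopic_lsq_ord f f' :
  isotopic (lsq f) (lsq f') -> isotopic (lsq_ord f) (lsq_ord f').
Proof.
have conj_bij (h : T -> T) : bijective h -> bijective (e \o h \o e').
  move=> bh; apply: bij_comp; last by exists e.
  by apply: bij_comp => //; exists e'.
case=> a [b [c [/conj_bij ba /conj_bij bb /conj_bij bc iso]]].
exists (e \o a \o e'), (e \o b \o e'), (e \o c \o e'); split=> // i j.
by rewrite /lsq_ord /= !eK iso.
Qed.

Notation V := (bool * (G * D))%type.

Definition lsq_pair (v : {ffun V -> bool}) (b : table_bit n) : bool :=
  let: (t, i, j, k) := b in nat_bit (lsq_ord (fun p => v (t, p)) i j) k.

Lemma encodes_lsq_pair v t : encodes (lsq_pair v) t (lsq_ord (fun p => v (t, p))).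
Proof.
move=> i j; rewrite /entry /lsq_pair sum_nat_bit //.
by apply: leq_trans (ltn_ord _) (up_logP _ _).
Qed.

Lemma lsq_pair_isotopy v : latin_square_isotopy (lsq_pair v) <->
  isotopic (lsq_ord (fun p => v (false, p))) (lsq_ord (fun p => v (true, p))).
Proof.
split=> [[op1 [op2 [enc1 enc2 _ _ [a [b [c [ba bb bc iso]]]]]]]|iso].
  have eq1 i j : lsq_ord (fun p => v (false, p)) i j = op1 i j.
    by apply: val_inj; rewrite /= -enc1 encodes_lsq_pair.
  have eq2 i j : lsq_ord (fun p => v (true, p)) i j = op2 i j.
    by apply: val_inj; rewrite /= -enc2 encodes_lsq_pair.
  by exists a, b, c; split=> // i j; rewrite eq1 eq2 iso.
exists (lsq_ord (fun p => v (false, p))), (lsq_ord (fun p => v (true, p))).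
by split=> //; [exact: encodes_lsq_pair | exact: encodes_lsq_pair
  | exact: quasigroup_lsq_ord | exact: quasigroup_lsq_ord].
Qed.

(** An entry involves at most one free bit, and a function of one Boolean is constant, the identity
    or negation. *)
Lemma lsq_pair_dep b : (exists c, forall v, lsq_pair v b = c) \/
  (exists u c, forall v, lsq_pair v b = v u (+) c).
Proof.
case: b => [[[t i] j] k]; rewrite /lsq_pair /lsq_ord.
case: (lsq_dep (e' i) (e' j)) => [[c lsqc]|[p [z [s lsqp]]]].
  by left; exists (nat_bit (e c) k) => v; rewrite lsqc.
pose bit a := nat_bit (e (inl (z, a (+) s))) k.
have [eq_bit|neq_bit] := eqVneq (bit false) (bit true).
  by left; exists (bit true) => v; rewrite lsqp -/(bit _); case: (v _).
right; exists (t, p), (bit false) => v; rewrite lsqp -/(bit _).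
by move: neq_bit; case: (v _); case: (bit true); case: (bit false).
Qed.

(** The set [bad] collects the translations carrying a constrained bit of the first square onto one
    of the second. It has at most |S|^2 elements, so some [a] avoids it, and a single [f] then meets
    both sets of constraints. *)
Lemma lsq_pair_dense (S : {set V}) (v0 : {ffun V -> bool}) :
  (#|S| * #|S| < #|G|)%N ->
  exists2 v, latin_square_isotopy (lsq_pair v) & {in S, v =1 v0}.
Proof.
move=> small.
pose bad := [set p.2.2.1 - p.1.2.1 | p in setX S S].
have /existsP[a a_ok] : [exists a, a \notin bad].
  rewrite -negb_forall; apply: contraTN small => /forallP all_bad.
  rewrite -leqNgt -cardsX; apply: leq_trans (leq_imset_card _ _).
  by apply: subset_leq_card; apply/subsetP => a _; apply: all_bad.
pose f (p : G * D) :=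
  if (true, p) \in S then v0 (true, p) else v0 (false, (p.1 - a, p.2)).
exists [ffun u : V => if u.1 then f u.2 else f (u.2.1 + a, u.2.2)].
  apply/lsq_pair_isotopy/isotopic_lsq_ord/(@isotopic_lsq_shift a) => x d.
  by rewrite !ffunE.
case=> [] [] [x d] Su; rewrite ffunE /f /= ?Su //.
rewrite ifN ?addrK //; apply: contra a_ok => Su'.
apply/imsetP; exists ((false, (x, d)), (true, (x + a, d))).
  by rewrite inE Su Su'.
by rewrite /= addrC addKr.
Qed.

(* Given the first square, an isotopic second one is determined by the three *)
(* bijections; [a] and [b] are the inverses of those on rows and columns.    *)
Lemma card_isotopic_lsq_pair (yes : pred {ffun V -> bool}) :
    (forall v, yes v -> latin_square_isotopy (lsq_pair v)) ->
  (#|yes| <= 2 ^ (#|G| * #|D|) * (n ^ n) ^ 3)%N.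
Proof.
move=> yesP; pose F := {ffun 'I_n -> 'I_n}.
pose code (q : {ffun G * D -> bool} * (F * F * F)) : {ffun V -> bool} :=
  let: (g, (a, b, c)) := q in
  [ffun u : V => let: (t, (x, d)) := u in
    if t then
      if e' (c (lsq_ord g (a (e (inl (x, false))))
                          (b (e (inl (x + delta (inr d), false))))))
        is inl (_, s) then s else false
    else g (x, d)].
have -> : (2 ^ (#|G| * #|D|) * (n ^ n) ^ 3 =
    #|[set: {ffun G * D -> bool} * (F * F * F)]|)%N.
  rewrite cardsT !card_prod !card_ffun card_prod card_bool card_ord.
  by rewrite !expnSr mul1n.
apply: leq_trans (leq_imset_card code _); apply: subset_leq_card.
apply/subsetP => v /yesP/lsq_pair_isotopy[a [b [c [bij_a bij_b _ iso]]]].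
have [[a' aK a'K] [b' bK b'K]] := (bij_a, bij_b).
apply/imsetP; exists ([ffun p => v (false, p)],
  ([ffun i => a' i], [ffun i => b' i], [ffun i => c i])) => //.
apply/ffunP => -[[] [x d]]; rewrite !ffunE //=.
have eq_lsq u w : lsq_ord [ffun p => v (false, p)] u w
                = lsq_ord (fun p => v (false, p)) u w.
  rewrite /lsq_ord; congr e; rewrite /lsq.
  case: (e' u) (e' w) => [[? ?]|?] [[? ?]|?] //.
  by case: (lab _) => // d'; rewrite ffunE.
by rewrite eq_lsq iso a'K b'K /lsq_ord !eK lsq_read.
Qed.

(** The condition on [w * w] gives density for CNFs, the last one makes at least half of the pairs
    non-isotopic, and the one on [w.-1] compares with the number of diagonal pairs (f, f) for
    DNFs. *)
Lemma depth2_size_bound (C : circuit (table_bit n)) (w : nat) :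
    depth2 C -> (forall x, Defs.eval C x <-> latin_square_isotopy x) ->
    (1 < n)%N -> (1 < w)%N -> (w * w <= #|G|)%N -> (w.-1 <= #|G| * #|D|)%N ->
    (2 * (n ^ n) ^ 3 <= 2 ^ (#|G| * #|D|))%N ->
  (2 ^ w.-1 <= circuit_size C)%N.
Proof.
move=> /orP[dnfC|cnfC] decC n_gt1 w_gt1 leG leGD count.
  pose diag (f : {ffun G * D -> bool}) := lsq_pair [ffun u : V => f u.2].
  have card_diag : #|{ffun G * D -> bool}| = (2 ^ (#|G| * #|D|))%N.
    by rewrite card_ffun card_prod card_bool.
  apply: (@leq_trans #|{ffun G * D -> bool}|).
    by rewrite card_diag leq_exp2l.
  apply: (dnf_yes_bound (inst := diag) n_gt1 dnfC decC) => [f g eq_fg|f].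
    apply/ffunP => -[x d].
    have : lsq_ord (fun p => [ffun u : V => f u.2] (true, p))
             (e (inl (x, false))) (e (inl (x + delta (inr d), false)))
         = lsq_ord (fun p => [ffun u : V => g u.2] (true, p))
             (e (inl (x, false))) (e (inl (x + delta (inr d), false))).
      apply: val_inj; rewrite /= -!encodes_lsq_pair; apply: entry_inj => k.
      exact: (eq_fg (_, _, _, k)).
    by move/(can_inj eK); rewrite !eK !lsq_read !ffunE => -[].
  apply/lsq_pair_isotopy/isotopic_lsq_ord/(@isotopic_lsq_shift 0) => x d.
  by rewrite !ffunE addr0.
have [ls [ts [le_ts evalC]]] := cnf_clauses cnfC.
apply: leq_trans le_ts.
pose yes (v : {ffun V -> bool}) := Defs.eval C (lsq_pair v).
apply: (@covering_bound _ _ lsq_pair lsq_pair_dep yes w _ ls) => // [S v0 ltS||].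
- have [|v yes_v vS] := @lsq_pair_dense S v0.
    by apply: leq_trans leG; apply: ltn_mul.
  by exists v => //; apply/decC.
- by move=> v; apply: evalC.
have := @card_isotopic_lsq_pair yes (fun v => proj1 (decC _)).
rewrite -(leq_pmul2l (isT : (0 < 2)%N)) => /leq_trans; apply.
rewrite !card_prod card_bool [(2 * (#|G| * _))%N]mul2n -addnn expnD mulnCA.
by rewrite leq_mul2l count orbT.
Qed.

End LatinSquares.

(** * Choice of parameters for a given order *)

Lemma card_eq_bij (S T : finType) : #|S| = #|T| ->
  exists f : S -> T, exists g : T -> S, cancel f g /\ cancel g f.
Proof.
move=> eqST; exists (fun x => enum_val (cast_ord eqST (enum_rank x))).
exists (fun y => enum_val (cast_ord (esym eqST) (enum_rank y))); split=> x.
  by rewrite enum_valK cast_ordK enum_rankK.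
by rewrite enum_valK cast_ordKV enum_rankK.
Qed.

Lemma ord_double_inj q : injective (fun x : 'I_(2 * q).+1 => (x + x)%R).
Proof.
(* In odd order 2q + 1 the inverse of 2 is q + 1. *)
move=> x y exy; have half (z : 'I_(2 * q).+1) : z = ((z + z) *+ q.+1)%R.
  rewrite -mulr2n -mulrnA mulnS -[(2 + _)%N]/((2 * q).+1.+1) mulrS.
  suff -> : (z *+ (2 * q).+1 = 0)%R by rewrite addr0.
  by apply: val_inj; rewrite Zp_mulrn /= modnMl.
by rewrite (half x) (half y); congr (_ *+ _)%R.
Qed.

Lemma ord_quasigroup k : exists op : 'I_k -> 'I_k -> 'I_k,
  (forall i, injective (op i)) /\ (forall j, injective (op^~ j)).
Proof.
case: k => [|k]; first by exists (fun i _ => i); split=> -[].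
by exists (fun i j => (i + j)%R); split=> i; [exact: addrI | exact: addIr].
Qed.

Lemma expn_gt_quartic t : 20 <= t -> 2 * (t ^ 2 + 1) ^ 2 + 3 <= 2 ^ t.-1.
Proof.
have base : 2 * (20 ^ 2 + 1) ^ 2 + 3 <= 2 ^ 20.-1 by rewrite [20.-1]/=; lia.
elim: t => [|t IH]; first by [].
rewrite leq_eqVlt => /predU1P[<-|]; first by exact: base.
rewrite ltnS => lb; apply: (@leq_trans (2 * 2 ^ t.-1)).
  apply: leq_trans (leq_mul (leqnn 2) (IH lb)).
  (* Squaring, the quartic grows by a factor at most 81/64 < 2 per step. *)
  have : 8 * (t.+1 ^ 2 + 1) <= 9 * (t ^ 2 + 1) by clear IH base; nia.
  by rewrite -leq_sqr !expnMn; clear IH base; lia.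
by rewrite -expnS; case: t lb {IH}.
Qed.

Lemma isotopy_counting m k t : k <= 3 -> 20 <= t -> (t ^ 2 + 1) ^ 2 <= m ->
  3 * (2 * m + k) * t + 1 <= m * (m - 2 * k).
Proof.
move=> hk ht hm.
have h0 : 400 <= t ^ 2 by rewrite -[400]/(20 ^ 2) leq_exp2r.
have h1 : 400 * t <= m by apply: leq_trans hm; nia.
have h2 : 3 * (2 * m + k) * t + 1 <= m * (8 * t) by nia.
by apply: leq_trans h2 _; rewrite leq_mul2l; apply/orP; right; lia.
Qed.

Lemma isotopy_depth2_size n (C : circuit (table_bit n)) : 2 ^ 20 <= n ->
    depth2 C -> (forall x, Defs.eval C x <-> latin_square_isotopy x) ->
  2 ^ (up_log 2 n) ^ 2 <= circuit_size C.
Proof.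
set t := up_log 2 n => le_n C2 decC.
have n_gt1 : 1 < n by apply: leq_trans le_n; rewrite -[1]/(2 ^ 0) ltn_exp2l.
have le_t : 20 <= t.
  have := leq_up_log 2 le_n; rewrite up_expnK; first exact; exact: isT.
have lt_n : 2 ^ t.-1 < n by apply: up_log_gtn.
have quartic := expn_gt_quartic le_t.
(* Since n = 4q + 2 + k, taking m = 2q + 1 keeps m odd and k at most 3. *)
pose q := (n - 2) %/ 4; pose k := (n - 2) %% 4.
have le_k : k <= 3 by rewrite -ltnS ltn_mod.
pose m := (2 * q).+1.
have eq_n : n = 2 * m + k.
  by rewrite /m /k /q; clear - n_gt1; lia.
have le_m : (t ^ 2 + 1) ^ 2 <= m.
  move: quartic lt_n; rewrite eq_n.
  move: (2 ^ t.-1) ((t ^ 2 + 1) ^ 2) le_k => A B le_k.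
  clear; lia.
have le_count := isotopy_counting le_k le_t le_m.
rewrite -eq_n in le_count.
have le_2k : 2 * k <= m.
  apply: leq_trans le_m; apply: (@leq_trans ((20 ^ 2 + 1) ^ 2)).
    by move: le_k; clear; lia.
  by rewrite leq_exp2r // leq_add2r leq_exp2r.
have [opK [opK_injl opK_injr]] := ord_quasigroup k.
have [lab [delta [labK deltaK]]] :=
  @card_eq_bij 'I_m (bool * 'I_k + 'I_(m - 2 * k))%type
  ltac:(by rewrite card_sum card_prod card_bool !card_ord subnKC).
have [e [e' [eK e'K]]] :=
  @card_eq_bij (('I_m * bool) + 'I_k)%type 'I_n
  ltac:(by rewrite card_sum card_prod card_bool !card_ord mulnC -eq_n).
have ge_t2 : t ^ 2 <= m * (m - 2 * k).
  apply: leq_trans le_count; rewrite -mulnn.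
  have le_tn : t <= n.
    by have := @ltn_expl 2 t.-1 isT; clear - lt_n; lia.
  by apply: leq_trans (leq_mul le_tn (leqnn t)) _; clear; lia.
have := @depth2_size_bound _ _ _ opK lab delta labK deltaK (@ord_double_inj q)
  opK_injl opK_injr n e e' eK e'K C (t ^ 2 + 1) C2 decC n_gt1.
rewrite !card_ord addn1 /=; apply=> //.
- by rewrite ltnS expn_gt0 (leq_trans _ le_t).
- by rewrite mulnn -addn1.
(* As n <= 2^t, the three bijections contribute at most 2^(3nt). *)
- rewrite -expnM; apply: (@leq_trans (2 ^ (t * (n * 3)).+1)).
    rewrite expnS leq_mul2l /= [X in _ <= X]expnM.
    rewrite leq_exp2r ?muln_gt0 ?(ltnW n_gt1) //.
    exact: up_logP.
  by rewrite leq_exp2l //; clear - le_count; lia.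
Qed.

(** * From powers of 2 to real exponents *)

Unset Implicit Arguments.
Local Open Scope ring_scope.

Theorem corollary1p2 (R : realType) :
  exists2 c : R, 0 < c & exists n0 : nat,
    forall C : circuit_family,
      (forall n : nat, (0 < n)%N -> depth2 (C n)) ->
      decides_latin_square_isotopy C ->
      forall n : nat, (n0 <= n)%N ->
        n%:R `^ (c * ln n%:R) <= (circuit_size (C n))%:R :> R.
Proof.
(* The constant 1 suffices: ln n <= t ln 2 and ln 2 <= 1 give (ln n)^2 <= t^2 ln 2. *)
exists 1 => //; exists (2 ^ 20)%N => C C2 decC n le_n.
have n_gt0 : (0 < n)%N by apply: leq_trans le_n; rewrite expn_gt0.
have := @isotopy_depth2_size n (C n) le_n (C2 n n_gt0) (decC n n_gt0).
set t := up_log 2 n; rewrite -(ler_nat R); apply: le_trans.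
have nR_gt0 : 0 < n%:R :> R by rewrite ltr0n.
have ln_ge0 : 0 <= ln n%:R :> R by rewrite ln_ge0 // ler1n.
have ln2_gt0 : 0 < ln 2 :> R by rewrite ln_gt0 // ltr1n.
have ln2_le1 : ln 2 <= 1 :> R.
  have := @le_ln1Dx R 1; rewrite -[1 + 1]/(2%:R); apply.
  by rewrite (lt_trans (ltrN10 _)).
have ln_le : ln n%:R <= t%:R * ln 2 :> R.
  rewrite mulr_natl -lnXn // ler_ln ?posrE ?exprn_gt0 // -natrX ler_nat.
  exact: up_logP.
rewrite mul1r /powR gt_eqF //.
rewrite natrX -[X in _ <= X]lnK ?posrE ?exprn_gt0 //.
rewrite ler_expR lnXn // -[X in _ <= X]mulr_natl natrX.
apply: (@le_trans _ _ ((t%:R * ln 2) ^+ 2)); last first.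
  by rewrite exprMn ler_wpM2l ?sqr_ge0 // expr2 ler_piMr // ltW.
by rewrite -expr2 ler_sqr ?nnegrE // mulr_ge0 ?ler0n // ltW.
Qed.
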